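(* Let $\mathbf{A} \in \mathcal{I}_{2,0}$. Then the following are equivalent: (1) $\mathbf{A} \models (x \to x) \to (y \to y) \approx y \to y$; (2) $\mathbf{A}$ is a Kleene algebra.
   Context: An implicator groupoid is an algebra $\mathbf A = \langle A, \to, 0 \rangle$, with $\to$ binary and $0$ a constant, which, writing $x' := x \to 0$, satisfies the identities (I) $(x \to y) \to z \approx [(z' \to x) \to (y \to z)']'$ and (I$_0$) $0'' \approx 0$. $\mathcal{I}_{2,0}$ is the variety of implicator groupoids satisfying $x'' \approx x$. Following the paper, an implicator groupoid is called a De Morgan algebra if it satisfies $(x \to y) \to x \approx x$; a De Morgan algebra is called a Kleene algebra if it satisfies either of the following two identities (which are equivalent for De Morgan algebras): (KL$_1$) $(x \to x) \to (y \to y)' \approx x \to x$; (KL$_2$) $(y \to y) \to (x \to x) \approx x \to x$. *)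

(* Defs.v *)
Record implicator_groupoid : Type := ImplicatorGroupoid {
  carrier :> Type;
  imp : carrier -> carrier -> carrier;
  zero : carrier;
  implicator_I : forall x y z : carrier,
    imp (imp x y) z =
    imp (imp (imp (imp z zero) x) (imp (imp y z) zero)) zero;
  implicator_I0 : imp (imp zero zero) zero = zero
}.

Arguments imp {_} _ _.
Arguments zero {_}.

Declare Scope implicator_scope.
Delimit Scope implicator_scope with imp.
Open Scope implicator_scope.

Notation "x ~> y" := (imp x y) (at level 55, right associativity)
  : implicator_scope.

Definition neg {A : implicator_groupoid} (x : A) : A := x ~> zero.

Notation "x ^'" := (neg x) (at level 2, left associativity, format "x ^'")
  : implicator_scope.

(* The record cannot use [neg] yet; these restate its axioms with it. *)
Lemma implicator_IE (A : implicator_groupoid) (x y z : A) :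
  (x ~> y) ~> z = ((z^' ~> x) ~> (y ~> z)^')^'.
Proof. exact (implicator_I A x y z). Qed.

Lemma implicator_I0E (A : implicator_groupoid) : (zero : A)^'^' = zero.
Proof. exact (implicator_I0 A). Qed.

Definition in_I20 (A : implicator_groupoid) : Prop :=
  forall x : A, x^'^' = x.

Definition is_de_morgan_algebra (A : implicator_groupoid) : Prop :=
  forall x y : A, (x ~> y) ~> x = x.

Definition KL1 (A : implicator_groupoid) : Prop :=
  forall x y : A, (x ~> x) ~> (y ~> y)^' = x ~> x.

Definition KL2 (A : implicator_groupoid) : Prop :=
  forall x y : A, (y ~> y) ~> (x ~> x) = x ~> x.

(* "Either identity" is a disjunction.  For De Morgan algebras [KL1] implies
   [KL2], but not conversely: the two-element Boolean algebra violates [KL1]. *)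
Definition is_kleene_algebra (A : implicator_groupoid) : Prop :=
  is_de_morgan_algebra A /\ (KL1 A \/ KL2 A).

(* Main.v *)
From Stdlib Require Import Setoid.
Require Import Defs.

(** Condition (1) is (KL2) with its variables exchanged, and a De Morgan
    algebra with (KL1) is trivial: taking both variables to be [zero] in (KL1)
    gives [zero^' = zero], while [zero^' ~> x = x] and [zero ~> x = zero^'].
    This settles (2) => (1).  What remains is that (1) implies
    [(x ~> y) ~> x = x].

    In every algebra of I_{2,0} one has [(x ~> y) ~> x = (zero ~> y) ~> x]
    ([imp_imp_self]) and [zero^' ~> x = x] ([one_imp]), so it suffices that
    [zero ~> y = zero^'] for all [y].  Write [f y] for [zero ~> y]; it is also
    [y^' ~> zero^'] ([imp_one]), and [f] is idempotent ([zero_imp_idem]).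
    Under (1), every [y ~> y] behaves, as far as [f] can see, like the unit
    [zero^']: [f (y ~> y) = zero^'] and [f ((y ~> y) ~> x) = f x].  For
    [u = f y], which is a fixed point of [f], these facts and [imp_imp_self]
    give
    [zero^' = f (u ~> u) = f (f u ~> u) = f ((u ~> u) ~> u) = f u = f y]. *)

(** * Identities valid throughout I_{2,0} *)

Lemma neg_inj {A : implicator_groupoid} (hA : in_I20 A) (x y : A) :
  x^' = y^' -> x = y.
Proof. intros e. now rewrite <- (hA x), <- (hA y), e. Qed.

Lemma one_imp {A : implicator_groupoid} (hA : in_I20 A) (x : A) :
  zero^' ~> x = x.
Proof.
  apply (neg_inj hA), (neg_inj hA).
  pose proof (implicator_IE A x zero zero) as e.
  change (x^'^' = ((zero^' ~> x) ~> zero^'^')^') in e.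
  rewrite (hA zero) in e. symmetry. exact e.
Qed.

Lemma zero_imp_imp {A : implicator_groupoid} (hA : in_I20 A) (x y : A) :
  (zero ~> x) ~> y = (y ~> (x ~> y)^')^'.
Proof.
  rewrite (implicator_IE A zero x y).
  change (y^' ~> zero) with (y^'^'). now rewrite hA.
Qed.

Lemma zero_imp_imp_one {A : implicator_groupoid} (hA : in_I20 A) (x : A) :
  (zero ~> x) ~> zero^' = x ~> zero^'.
Proof. now rewrite (zero_imp_imp hA), (one_imp hA), hA. Qed.

Lemma zero_imp_one {A : implicator_groupoid} (hA : in_I20 A) :
  (zero : A) ~> zero^' = zero^'.
Proof.
  rewrite <- (zero_imp_imp_one hA).
  change ((zero : A) ~> zero) with ((zero : A)^'). apply (one_imp hA).
Qed.

(** Contraposition, which fails in general here, holds when one side is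
    [zero] or [zero^']. *)
Lemma imp_one {A : implicator_groupoid} (hA : in_I20 A) (x : A) :
  x ~> zero^' = zero ~> x^'.
Proof.
  rewrite <- (hA x) at 1. change (x^'^') with (x^' ~> zero).
  rewrite (implicator_IE A (x^') zero), (zero_imp_one hA), !hA.
  change ((zero ~> x^') ~> zero) with ((zero ~> x^')^'). apply hA.
Qed.

Lemma zero_imp_neg_zero_imp {A : implicator_groupoid} (hA : in_I20 A) (x : A) :
  zero ~> (zero ~> x)^' = zero ~> x^'.
Proof. rewrite <- !(imp_one hA). apply (zero_imp_imp_one hA). Qed.

(** Writing [f] for [zero ~> _], the rule [f (y^') = f ((f y)^')] removes an
    [f] that stands under a negation.  In [f (f x)] the inner [f] is bare, but
    reading the rule backwards at [y = (f x)^'] puts it under one: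
    [f (f x) = f ((f ((f x)^'))^') = f ((f (x^'))^') = f x]. *)
Lemma zero_imp_idem {A : implicator_groupoid} (hA : in_I20 A) (x : A) :
  zero ~> (zero ~> x) = zero ~> x.
Proof.
  rewrite <- (hA (zero ~> x)) at 1.
  now rewrite <- (zero_imp_neg_zero_imp hA (_^')), (zero_imp_neg_zero_imp hA x),
    (zero_imp_neg_zero_imp hA), hA.
Qed.

Lemma neg_imp_self {A : implicator_groupoid} (hA : in_I20 A) (x : A) :
  x^' ~> x = x.
Proof.
  assert (e : forall y : A, y ~> y^' = y^').
  { intros y. apply (neg_inj hA).
    rewrite <- (one_imp hA y) at 2.
    now rewrite <- (zero_imp_imp hA), (zero_imp_one hA), (one_imp hA). }
  specialize (e (x^')). now rewrite hA in e.
Qed.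

(** Both sides are instances of (I), with right-hand sides that agree because
    [y^' ~> y = y = y^'^']; in particular [(y ~> x) ~> y] depends on [x] only through
    [zero ~> x]. *)
Lemma imp_imp_self {A : implicator_groupoid} (hA : in_I20 A) (x y : A) :
  (y ~> x) ~> y = (zero ~> x) ~> y.
Proof.
  now rewrite (zero_imp_imp hA), (implicator_IE A y x y), (neg_imp_self hA).
Qed.

(** * Condition (1) forces the De Morgan identity *)

(** The absorption [(y ~> y) ~> zero^' = zero^'], which is (1) at
    [zero ~> zero], is what removes [y ~> y] here. *)
Lemma zero_imp_neg_imp_self {A : implicator_groupoid} (hA : in_I20 A)
    (H : forall x y : A, (x ~> x) ~> (y ~> y) = y ~> y) (x y : A) :
  zero ~> (x ~> (y ~> y))^' = zero ~> x.
Proof.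
  rewrite <- (imp_one hA), (implicator_IE A x (y ~> y)), hA.
  pose proof (H y zero) as e.
  change ((y ~> y) ~> zero^' = zero^') in e.
  rewrite e, hA. exact (hA (zero ~> x)).
Qed.

Lemma zero_imp_self {A : implicator_groupoid} (hA : in_I20 A)
    (H : forall x y : A, (x ~> x) ~> (y ~> y) = y ~> y) (x : A) :
  zero ~> (x ~> x) = zero^'.
Proof.
  rewrite <- (zero_imp_neg_imp_self hA H _ x), H, <- (imp_one hA).
  exact (H x zero).
Qed.

Lemma zero_imp_self_imp {A : implicator_groupoid} (hA : in_I20 A)
    (H : forall x y : A, (x ~> x) ~> (y ~> y) = y ~> y) (x y : A) :
  zero ~> ((x ~> x) ~> y) = zero ~> y.
Proof.
  (* Inside [zero ~> _^'], appending [~> (x ~> x)] changes nothing; doing so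
     to [(x ~> x) ~> y] produces the left side of [imp_imp_self]. *)
  rewrite <- (zero_imp_neg_imp_self hA H _ x), (imp_imp_self hA).
  now rewrite (zero_imp_neg_imp_self hA H), (zero_imp_idem hA).
Qed.

Lemma zero_imp_eq_one {A : implicator_groupoid} (hA : in_I20 A)
    (H : forall x y : A, (x ~> x) ~> (y ~> y) = y ~> y) (x : A) :
  zero ~> x = zero^'.
Proof.
  set (u := zero ~> x).
  assert (fixed_u : zero ~> u = u) by apply (zero_imp_idem hA).
  rewrite <- (zero_imp_self hA H u).
  rewrite <- fixed_u at 2.
  now rewrite <- (imp_imp_self hA), (zero_imp_self_imp hA H).
Qed.

Lemma de_morgan_of_self_imp {A : implicator_groupoid} (hA : in_I20 A)
    (H : forall x y : A, (x ~> x) ~> (y ~> y) = y ~> y) :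
  is_de_morgan_algebra A.
Proof.
  intros x y.
  now rewrite (imp_imp_self hA), (zero_imp_eq_one hA H), (one_imp hA).
Qed.

(** * De Morgan algebras with (KL1) *)

(** In a De Morgan algebra [x ~> x] and [(y ~> y)^'] are the join and the meet
    of an element with its complement, so (KL1) at [zero] makes the bottom
    element equal to the top. *)
Lemma de_morgan_KL1_trivial {A : implicator_groupoid} (hA : in_I20 A)
    (hDM : is_de_morgan_algebra A) (hKL : KL1 A) (x : A) :
  x = zero^'.
Proof.
  pose proof (hKL zero zero) as e.
  change (zero^' ~> zero^'^' = (zero : A)^') in e.
  rewrite (one_imp hA), hA in e.
  transitivity (zero ~> x).
  - pose proof (one_imp hA x) as ex. rewrite <- e in ex. now symmetry.
  - apply (neg_inj hA). rewrite hA. exact (hDM zero x).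
Qed.

Theorem theorem3p3 (A : implicator_groupoid) (hA : in_I20 A) :
  (forall x y : A, (x ~> x) ~> (y ~> y) = y ~> y) <-> is_kleene_algebra A.
Proof.
  split.
  - intros H. split.
    + exact (de_morgan_of_self_imp hA H).
    + right. intros x y. apply H.
  - intros [hDM [hKL | hKL]] x y.
    + transitivity (zero^' : A).
      * apply (de_morgan_KL1_trivial hA hDM hKL).
      * symmetry. apply (de_morgan_KL1_trivial hA hDM hKL).
    + apply hKL.
Qed.
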